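(* A cubic algebra $\mathcal L$ has a g-cover if and only if $\mathcal L$ is isomorphic (as a cubic algebra) to $\mathsf I(\mathcal I)$ for some implication algebra $\mathcal I$.
   Context: A cubic algebra is a join-semilattice $\mathcal L$ with top $\mathbf 1$ and a binary operation $\Delta$ such that: if $x\le y$ then $\Delta(y,x)\vee x=y$; if $x\le y\le z$ then $\Delta(z,\Delta(y,x))=\Delta(\Delta(z,y),\Delta(z,x))$; if $x\le y$ then $\Delta(y,\Delta(y,x))=x$; if $x\le y\le z$ then $\Delta(z,x)\le\Delta(z,y)$; and with $xy:=\Delta(\mathbf 1,\Delta(x\vee y,y))\vee y$ one has $(xy)y=x\vee y$ and $x(yz)=y(xz)$. With the operation $xy$, $\mathcal L$ is an implication algebra; an implication subalgebra is a subset closed under this operation. For $a,b\in\mathcal L$, $a\sim b$ iff $\Delta(a\vee b,a)=b$; $\sim$ is an equivalence relation and $\mathcal L/\!\sim$ is an implication algebra with order $[a]\le[b]$ iff $\Delta(a\vee b,a)\le b$, join $[a]\vee[b]=[a\vee\Delta(a\vee b,b)]$ and implication $[a]\to[b]=[\Delta(a\vee b,a)\,b]$. Let $\eta\colon\mathcal L\to\mathcal L/\!\sim$ be the quotient map. A g-cover of $\mathcal L$ is an upwards-closed implication subalgebra $J\subseteq\mathcal L$ such that the restriction $\eta|_J\colon J\to\mathcal L/\!\sim$ is an isomorphism of implication algebras. An implication algebra is a join-semilattice with top in which every interval $[a,\mathbf 1]$ is Boolean, with $x\to y$ the complement of $x\vee y$ in $[y,\mathbf 1]$. For an implication algebra $\mathcal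 I$, $\mathsf I(\mathcal I)=\{\langle a,b\rangle : a\vee b=\mathbf 1,\ a\wedge b\text{ exists}\}$ ordered componentwise, with componentwise join, top $\langle\mathbf 1,\mathbf 1\rangle$ and, for $\langle c,d\rangle\le\langle a,b\rangle$, $\Delta(\langle a,b\rangle,\langle c,d\rangle)=\langle a\wedge(b\to d),b\wedge(a\to c)\rangle$; it is a cubic algebra. *)

(* Defs.v *)
From HB Require Import structures.
From mathcomp Require Import all_boot all_order.
From mathcomp Require Import boolp classical_sets functions.

Set Implicit Arguments.
Unset Strict Implicit.
Unset Printing Implicit Defensive.

Import Order.Theory.
Local Open Scope order_scope.

(* The derived operation [xy] of a cubic algebra, for a candidate [D] for
   Delta. *)
Definition cubic_imp_of d (L : tJoinSemilatticeType d) (D : L -> L -> L)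
  (x y : L) : L := D \top (D (x `|` y) y) `|` y.

HB.mixin Record isCubic d L of Order.TJoinSemilattice d L := {
  Delta : L -> L -> L;
  Delta_join : forall x y, x <= y -> Delta y x `|` x = y;
  Delta_distr : forall x y z, x <= y -> y <= z ->
    Delta z (Delta y x) = Delta (Delta z y) (Delta z x);
  DeltaK : forall x y, x <= y -> Delta y (Delta y x) = x;
  Delta_mono : forall x y z, x <= y -> y <= z -> Delta z x <= Delta z y;
  cubic_impK : forall x y,
    cubic_imp_of Delta (cubic_imp_of Delta x y) y = x `|` y;
  cubic_impCA : forall x y z,
    cubic_imp_of Delta x (cubic_imp_of Delta y z) =
    cubic_imp_of Delta y (cubic_imp_of Delta x z)
}.

#[short(type="cubicType")]
HB.structure Definition Cubic d :=
  { L of isCubic d L & Order.TJoinSemilattice d L }.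

Section CubicTheory.
Context d (L : cubicType d).
Implicit Types (a b x y : L) (A B J : set L).

Definition cimp x y := cubic_imp_of (@Delta d L) x y.

Definition csim a b : Prop := Delta (a `|` b) a = b.

(* The quotient map, with L/~ realised as the set [range cclass] of
   equivalence classes. *)
Definition cclass a : set L := [set b | csim a b]%classic.

(* The implication of L/~.  As [Delta (a `|` b) a * b] has a class that only
   depends on those of [a] and [b], taking the union over all representatives
   yields a single class, with no choice of representatives. *)
Definition class_imp A B : set L :=
  (\bigcup_(a in A) \bigcup_(b in B)
     cclass (cimp (Delta (a `|` b)%O a) b))%classic.

Definition upward_closed J := forall x y, J x -> x <= y -> J y.

Definition imp_subalgebra J := forall x y, J x -> J y -> J (cimp x y).

Definition g_cover J :=
  [/\ upward_closed J,
      imp_subalgebra J,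
      set_bij J (range cclass)%classic cclass
    & forall x y, J x -> J y ->
        cclass (cimp x y) = class_imp (cclass x) (cclass y)].

End CubicTheory.

(* The axioms say nothing about [Delta y x] when [x] is not below [y], so only
   the values with [x <= y] belong to the structure to be preserved. *)
Definition cubic_iso d d' (L : cubicType d) (M : cubicType d') (f : L -> M) :=
  [/\ bijective f,
      {morph f : x y / x `|` y},
      f \top = \top
    & forall x y, x <= y -> f (Delta y x) = Delta (f y) (f x)].

Definition has_meet d (T : porderType d) (x y : T) : Prop :=
  (infimums [set x; y] !=set0)%classic.

(* The meet of [x] and [y] when it exists; [\top] otherwise. *)
Definition pmeet d (T : tPOrderType d) (x y : T) : T :=
  infimum \top [set x; y]%classic.

(* The interval [a, \top] is Boolean.  Meets are taken in the whole algebra: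
   in a join-semilattice a meet in [a, \top] is a meet in the algebra. *)
Definition boolean_above d (T : tJoinSemilatticeType d) (a : T) : Prop :=
  [/\ forall x y, a <= x -> a <= y -> has_meet x y,
      forall x y z, a <= x -> a <= y -> a <= z ->
        pmeet x (y `|` z) = pmeet x y `|` pmeet x z
    & forall x, a <= x ->
        exists y, [/\ a <= y, x `|` y = \top & pmeet x y = a]].

HB.mixin Record isImplication d I of Order.TJoinSemilattice d I := {
  boolean_aboveP : forall a : I, boolean_above a;
  imp : I -> I -> I;
  imp_ge : forall x y, y <= imp x y;
  imp_join : forall x y, (x `|` y) `|` imp x y = \top;
  imp_meet : forall x y, pmeet (x `|` y) (imp x y) = y
}.

#[short(type="implType")]
HB.structure Definition Implication d :=
  { I of isImplication d I & Order.TJoinSemilattice d I }.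

Section PartialMeet.
Context d (T : tPOrderType d).
Implicit Types x y z m : T.

Lemma infimums2P x y m :
  infimums [set x; y]%classic m <->
  [/\ m <= x, m <= y & forall z, z <= x -> z <= y -> z <= m].
Proof.
split=> [[lb ub]|[mx my lub]].
  split; [by apply: lb; left|by apply: lb; right|move=> z zx zy].
  by apply: ub => t [->|->].
split=> [t [->|->] //|z lbz]; apply: lub; apply: lbz; [by left|by right].
Qed.

Lemma pmeet_unique x y m : m <= x -> m <= y ->
  (forall z, z <= x -> z <= y -> z <= m) -> pmeet x y = m.
Proof.
move=> mx my lub; have infm : infimums [set x; y]%classic m by apply/infimums2P.
rewrite /pmeet /infimum ifF.
  exact: xget_subset1 infm (@is_subset1_infimums _ _ _).
by apply/negbTE/set0P; exists x; left.
Qed.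

Lemma pmeetP x y : has_meet x y ->
  [/\ pmeet x y <= x, pmeet x y <= y
    & forall z, z <= x -> z <= y -> z <= pmeet x y].
Proof.
by case=> m /infimums2P[mx my lub]; rewrite (pmeet_unique mx my lub).
Qed.

Lemma pmeetC x y : pmeet x y = pmeet y x.
Proof. by rewrite /pmeet setUC. Qed.

End PartialMeet.

(* The interval [m, \top] as a Boolean algebra. *)
Section Above.
Context d (I : implType d) (m : I).

Definition above := {x : I | m <= x}.

HB.instance Definition _ := SubChoice.on above.
HB.instance Definition _ := [SubChoice_isSubPOrder of above by <: with d].

Implicit Types u v w : above.

Lemma above_has_meet u v : has_meet (val u) (val v).
Proof. by case: (boolean_aboveP m) => + _ _; apply; apply: valP. Qed.

Fact above_join_subproof u v : m <= val u `|` val v.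
Proof. exact: le_trans (valP u) (leUl _ _). Qed.

Fact above_meet_subproof u v : m <= pmeet (val u) (val v).
Proof. by case: (pmeetP (above_has_meet u v)) => _ _; apply; apply: valP. Qed.

Definition above_join u v : above := Sub _ (above_join_subproof u v).
Definition above_meet u v : above := Sub _ (above_meet_subproof u v).
Definition above_top : above := Sub \top (lex1 m).
Definition above_bot : above := Sub m (lexx m).
Definition above_compl u : above := Sub _ (imp_ge (val u) m).

Fact above_meetP u v w : (u <= above_meet v w) = (u <= v) && (u <= w).
Proof.
rewrite -!Order.le_val /=; case: (pmeetP (above_has_meet v w)) => l1 l2 l3.
apply/idP/andP => [le|[]]; last exact: l3.
by split; apply: le_trans le _.
Qed.

Fact above_joinP u v w : (above_join u v <= w) = (u <= w) && (v <= w).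
Proof. exact: leUx. Qed.

HB.instance Definition _ := @Order.POrder_MeetJoin_isLattice.Build d above
  above_meet above_join above_meetP above_joinP.

Fact above_meetUl :
  @left_distributive above above Order.meet Order.join.
Proof.
move=> u v w; apply/val_inj => /=.
case: (boolean_aboveP m) => _ + _ => /(_ (val w) (val u) (val v)).
rewrite (pmeetC _ (val w)) => ->; try exact: valP.
by rewrite !(pmeetC (val w)).
Qed.

HB.instance Definition _ :=
  Order.Lattice_Meet_isDistrLattice.Build d above above_meetUl.

Fact above_lex1 u : u <= above_top. Proof. exact: lex1. Qed.
Fact above_le0x u : above_bot <= u. Proof. exact: (valP u). Qed.

HB.instance Definition _ := Order.hasTop.Build d above above_lex1.
HB.instance Definition _ := Order.hasBottom.Build d above above_le0x.

Fact above_joinxC u : u `|` above_compl u = \top.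
Proof.
apply: val_inj => /=; have := imp_join (val u) m.
by rewrite (join_l (valP u)).
Qed.

Fact above_meetxC u : u `&` above_compl u = \bot.
Proof.
apply: val_inj => /=; have := imp_meet (val u) m.
by rewrite (join_l (valP u)).
Qed.

HB.instance Definition _ := Order.TBDistrLattice_hasComplement.Build d above
  above_joinxC above_meetxC.

End Above.

Lemma compl_unique d (B : ctbDistrLatticeType d) (u w : B) :
  u `|` w = \top -> u `&` w = \bot -> w = ~` u.
Proof.
move=> uw1 uw0; apply: le_anti; apply/andP; split.
  by rewrite -[w]meet1x -(joinCx u) meetUl uw0 joinx0 leIl.
by rewrite -[~` u]meet1x -uw1 meetUl meetxC join0x leIl.
Qed.

Section ImplicationTheory.
Context d (I : implType d).
Implicit Types m x y z : I.

Lemma aboveE m x : m <= x -> {u : above m | x = val u}.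
Proof. by move=> mx; exists (Sub x mx). Qed.

Lemma imp_unique x y w : y <= w ->
  (x `|` y) `|` w = \top -> pmeet (x `|` y) w = y -> imp x y = w.
Proof.
move=> yw st1 st0; have H1 := imp_join x y; have H0 := imp_meet x y.
have [s sE] := aboveE (leUr y x); have [t tE] := aboveE yw.
have [r rE] := aboveE (imp_ge x y).
rewrite sE tE rE in st1 st0 H1 H0 *.
have -> // : r = t.
have -> : r = ~` s by apply: compl_unique; apply: val_inj.
by apply/esym/compl_unique; apply: val_inj.
Qed.

Lemma imp_joinl x y : imp (x `|` y) y = imp x y.
Proof.
apply/esym/imp_unique; first exact: imp_ge.
  by have := imp_join (x `|` y) y; rewrite joinUK.
by have := imp_meet (x `|` y) y; rewrite joinUK.
Qed.

Lemma imp_above m (u v : above m) : imp (val u) (val v) = val (~` u `|` v : above m).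
Proof.
apply: imp_unique; first exact: (leUr v (~` u)).
  suff /(congr1 val) : (u `|` v) `|` (~` u `|` v) = \top by [].
  by rewrite joinACA joinxC join1x.
suff /(congr1 val) : (u `|` v) `&` (~` u `|` v) = v by [].
by rewrite -joinIl meetxC join0x.
Qed.

Lemma imp_aboveE m x (v : above m) :
  imp x (val v) = val (~` (Sub (x `|` m) (leUr m x) : above m) `|` v : above m).
Proof.
rewrite -imp_above /= -imp_joinl -[RHS]imp_joinl.
by rewrite -joinA (join_r (valP v)).
Qed.

Lemma imp_above0 m (u : above m) : imp (val u) m = val (~` u).
Proof. by rewrite (imp_above u \bot) joinx0. Qed.

Lemma imp_above0E m x :
  imp x m = val (~` (Sub (x `|` m) (leUr m x) : above m)).
Proof. by rewrite -imp_above0 imp_joinl. Qed.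

Lemma impK x y : imp (imp x y) y = x `|` y.
Proof. by rewrite (imp_above0E y x) imp_above0 complK. Qed.

Lemma impCA x y z : imp x (imp y z) = imp y (imp x z).
Proof. by rewrite (imp_above0E z x) (imp_above0E z y) !imp_aboveE joinC. Qed.

Lemma has_meet_bounded m x y : m <= x -> m <= y -> has_meet x y.
Proof. by case: (boolean_aboveP m) => + _ _; apply. Qed.

End ImplicationTheory.

Section BooleanIdentities.
Context d (B : ctbDistrLatticeType d).
Implicit Types a b c e p q : B.

Lemma meet_joinC a b : a `&` (~` a `|` b) = a `&` b.
Proof. by rewrite meetUr meetxC join0x. Qed.

Lemma joinC_meet a b : ~` a `|` (a `&` b) = ~` a `|` b.
Proof. by rewrite joinIr joinCx meet1x. Qed.

Lemma bool_Delta_top a b c e : a `|` b = \top -> c `|` e = \top ->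
  (a `&` (~` b `|` e)) `|` (b `&` (~` a `|` c)) = \top.
Proof.
move=> ab ce.
rewrite joinIl !joinIr ab meet1x.
rewrite [a `|` _]joinA joinxC join1x meet1x.
rewrite [~` b `|` e `|` b]joinAC joinCx join1x meet1x.
by rewrite joinACA [e `|` c]joinC ce joinx1.
Qed.

Lemma bool_Delta_join a b c e : c <= a -> c `|` e = \top ->
  (a `&` (~` b `|` e)) `|` c = a.
Proof.
by move=> ca ce; rewrite joinIl (join_l ca) -joinA [e `|` c]joinC ce joinx1 meetx1.
Qed.

Lemma bool_DeltaK a b c : c <= a -> ~` c <= b ->
  a `&` (~` b `|` (b `&` (~` a `|` c))) = c.
Proof.
move=> ca cb; rewrite joinC_meet joinCA meet_joinC.
have -> : ~` b `|` c = c by apply: join_r; rewrite -[c]complK leC.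
exact: meet_r.
Qed.

Lemma bool_Delta_distr a b c p q :
  p `&` (~` q `|` (b `&` (~` a `|` c))) =
  (p `&` (~` q `|` b)) `&`
  (~` (q `&` (~` p `|` a)) `|` (q `&` (~` p `|` c))).
Proof.
rewrite complI complU complK [_ `|` (q `&` _)]joinAC joinC_meet.
rewrite -[_ `|` (p `&` _)]joinA [_ `|` (p `&` _)]joinAC joinC_meet -joinA.
by rewrite joinIr meetAC meetA [~` q `|` (~` p `|` _)]joinCA meet_joinC meetAC.
Qed.

Lemma bool_imp a b c e : c `|` e = \top -> e <= b ->
  (b `&` (~` a `|` c)) `|` c = ~` a `|` c.
Proof.
move=> ce eb; rewrite joinIl joinUK -[b](join_l eb) -joinA [e `|` c]joinC ce.
by rewrite joinx1 meet1x.
Qed.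

End BooleanIdentities.

Section Interval.
Context d (I : implType d).

Definition is_interval (p : I *p I) : Prop :=
  p.1 `|` p.2 = \top /\ has_meet p.1 p.2.

Definition interval_alg := {p : I *p I | `[< is_interval p >]}.

HB.instance Definition _ := SubChoice.on interval_alg.
HB.instance Definition _ := [SubChoice_isSubPOrder of interval_alg by <: with d].

Implicit Types (m : I) (x y z : interval_alg).

Lemma intervalP x : is_interval (val x).
Proof. exact/asboolP/(valP x). Qed.

Lemma interval_le x y :
  (x <= y) = ((val x).1 <= (val y).1) && ((val x).2 <= (val y).2).
Proof. by []. Qed.

Fact interval_join_subproof x y :
  `[< is_interval ((val x).1 `|` (val y).1, (val x).2 `|` (val y).2) >].
Proof.
apply/asboolP; case: (intervalP x) => x1 /pmeetP[mx1 mx2 _] /=; split=> /=.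
  by rewrite joinACA x1 join1x.
by apply: (@has_meet_bounded _ _ (pmeet (val x).1 (val x).2)); rewrite lexU2 ?mx1 ?mx2.
Qed.

Definition interval_join x y : interval_alg := exist _ (_, _) (interval_join_subproof x y).

Fact interval_leUx x y z : (interval_join x y <= z) = (x <= z) && (y <= z).
Proof. by rewrite !interval_le /= !leUx; do ?case: (_ <= _). Qed.

HB.instance Definition _ :=
  Order.POrder_isJoinSemilattice.Build d interval_alg interval_leUx.

Fact interval_top_subproof : `[< is_interval (\top, \top) >].
Proof.
apply/asboolP; split => /=; first by rewrite joinxx.
exact: (@has_meet_bounded _ _ \top).
Qed.

Definition interval_top : interval_alg := exist _ (\top, \top) interval_top_subproof.

Fact interval_lex1 x : x <= interval_top.
Proof. by rewrite interval_le /= !lex1. Qed.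

HB.instance Definition _ := Order.hasTop.Build d interval_alg interval_lex1.

(* The formula defines an element of [interval_alg] when [y <= x], see
   [interval_DeltaE]; it is irrelevant otherwise. *)
Definition interval_Delta x y : interval_alg :=
  insubd interval_top (pmeet (val x).1 (imp (val x).2 (val y).2),
                       pmeet (val x).2 (imp (val x).1 (val y).1)).

Lemma intervalE x : {m : I & {c : above m | val x = (val c, val (~` c))}}.
Proof.
case: (intervalP x); case: (val x) => x1 x2 /= x12 hm.
have [m1 m2 _] := pmeetP hm; exists (pmeet x1 x2).
have [c cE] := aboveE m1; have [e eE] := aboveE m2; exists c.
have ecE : e = ~` c.
  by apply: compl_unique; apply: val_inj; rewrite /= -cE -eE.
by rewrite ecE in eE; exact: (f_equal2 pair cE eE).
Qed.

Lemma above_pairE m x y (c e : above m) : val y = (val c, val e) -> y <= x ->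
  exists a b : above m,
    [/\ val x = (val a, val b), c <= a, e <= b & a `|` b = \top].
Proof.
rewrite interval_le => ->; case: (intervalP x).
case: (val x) => p1 p2 /= p12 _ /andP[le1 le2].
have [a aE] := aboveE (le_trans (valP c) le1).
have [b bE] := aboveE (le_trans (valP e) le2).
exists a, b; rewrite -!Order.le_val; rewrite aE in le1 p12 *; rewrite bE in le2 p12 *.
by split; rewrite ?aE ?bE //; apply: val_inj.
Qed.

Lemma val_interval_join m x y (a b c e : above m) :
  val x = (val a, val b) -> val y = (val c, val e) ->
  val (x `|` y) = (val (a `|` c), val (b `|` e)).
Proof. by move=> xE yE; rewrite [LHS]/= xE yE. Qed.

Lemma pair_valE m (a b a' b' : above m) : a = a' -> b = b' ->
  (val a, val b) = (val a', val b').
Proof. by move=> -> ->. Qed.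

Lemma val_interval_Delta m x y (a b c e : above m) :
  val x = (val a, val b) -> val y = (val c, val e) ->
  val (interval_Delta x y) =
  (val (a `&` (~` b `|` e)), val (b `&` (~` a `|` c))).
Proof.
move=> xE yE.
have ab : a `|` b = \top.
  by apply: val_inj; case: (intervalP x); rewrite xE.
have ce : c `|` e = \top.
  by apply: val_inj; case: (intervalP y); rewrite yE.
rewrite /interval_Delta xE yE [in LHS]/fst [in LHS]/snd !imp_above insubdK //.
apply/asboolP; split; last first.
  exact: (above_has_meet (a `&` (~` b `|` e)) (b `&` (~` a `|` c))).
exact: (congr1 val (bool_Delta_top ab ce)).
Qed.

Lemma interval_DeltaE x y : y <= x ->
  val (interval_Delta x y) =
  (pmeet (val x).1 (imp (val x).2 (val y).2),
   pmeet (val x).2 (imp (val x).1 (val y).1)).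
Proof.
have [m [c yE]] := intervalE y; move=> yx.
have [a [b [xE _ _ _]]] := above_pairE yE yx.
by rewrite (val_interval_Delta xE yE) xE yE [in RHS]/fst [in RHS]/snd !imp_above.
Qed.

Fact interval_Delta_join x y : x <= y -> interval_Delta y x `|` x = y.
Proof.
have [m [c xE]] := intervalE x; move=> xy.
have [a [b [yE ca cb ab]]] := above_pairE xE xy.
apply: val_inj; rewrite (val_interval_join (val_interval_Delta yE xE) xE) yE.
by apply: pair_valE; apply: bool_Delta_join => //; rewrite ?joinxC ?joinCx.
Qed.

Fact interval_Delta_distr x y z : x <= y -> y <= z ->
  interval_Delta z (interval_Delta y x) =
  interval_Delta (interval_Delta z y) (interval_Delta z x).
Proof.
move=> xy yz; have xz := le_trans xy yz.
have [m [c xE]] := intervalE x.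
have [a [b [yE _ _ _]]] := above_pairE xE xy.
have [p [q [zE _ _ _]]] := above_pairE xE xz.
have yxE := val_interval_Delta yE xE; have zxE := val_interval_Delta zE xE.
have zyE := val_interval_Delta zE yE.
apply: val_inj; rewrite (val_interval_Delta zE yxE) (val_interval_Delta zyE zxE).
by rewrite -!bool_Delta_distr.
Qed.

Fact interval_DeltaK x y : x <= y ->
  interval_Delta y (interval_Delta y x) = x.
Proof.
have [m [c xE]] := intervalE x; move=> xy.
have [a [b [yE ca cb ab]]] := above_pairE xE xy.
apply: val_inj; rewrite (val_interval_Delta yE (val_interval_Delta yE xE)) xE.
by rewrite (bool_DeltaK ca cb) bool_DeltaK // complK.
Qed.

Fact interval_Delta_mono x y z : x <= y -> y <= z ->
  interval_Delta z x <= interval_Delta z y.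
Proof.
move=> xy yz; have xz := le_trans xy yz.
have [m [c xE]] := intervalE x.
have [a [b [yE ca cb _]]] := above_pairE xE xy.
have [p [q [zE _ _ _]]] := above_pairE xE xz.
rewrite interval_le (val_interval_Delta zE xE) (val_interval_Delta zE yE).
suff: (p `&` (~` q `|` ~` c) <= p `&` (~` q `|` b)) &&
      (q `&` (~` p `|` c) <= q `&` (~` p `|` a)) by [].
by rewrite !leI2 // leU2.
Qed.

Lemma val_interval_imp x y :
  val (cubic_imp_of interval_Delta x y) =
  (imp (val x).1 (val y).1, imp (val x).2 (val y).2).
Proof.
have yU : y <= x `|` y by exact: leUr.
have [m [c yE]] := intervalE y.
have [a [b [UE ca cb ab]]] := above_pairE yE yU.
have dE := val_interval_Delta UE yE.
have tE : val (\top : interval_alg) = (val (\top : above m), val (\top : above m)).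
  by [].
rewrite /cubic_imp_of (val_interval_join (val_interval_Delta tE dE) yE).
have [aE bE] : (val x).1 `|` val c = val a /\ (val x).2 `|` val (~` c) = val b.
  by move: UE; rewrite [LHS]/= yE => -[aE bE]; split; [exact: aE|exact: bE].
have -> : (imp (val x).1 (val y).1, imp (val x).2 (val y).2) =
    (val (~` a `|` c), val (~` b `|` ~` c)).
  rewrite yE [in LHS]/fst [in LHS]/snd -[imp _ (val c)]imp_joinl.
  by rewrite -[imp _ (val (~` c))]imp_joinl aE bE !imp_above.
rewrite compl1 !join0x !meet1x.
apply: pair_valE; first exact: bool_imp (joinxC c) cb.
exact: bool_imp (joinCx c) ca.
Qed.

Fact interval_impK x y : cubic_imp_of interval_Delta
  (cubic_imp_of interval_Delta x y) y = x `|` y.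
Proof. by apply: val_inj; rewrite !val_interval_imp /= !impK. Qed.

Fact interval_impCA x y z :
  cubic_imp_of interval_Delta x (cubic_imp_of interval_Delta y z) =
  cubic_imp_of interval_Delta y (cubic_imp_of interval_Delta x z).
Proof.
by apply: val_inj; rewrite !val_interval_imp /=; congr (_, _); exact: impCA.
Qed.

HB.instance Definition _ := @isCubic.Build d interval_alg interval_Delta
  interval_Delta_join interval_Delta_distr interval_DeltaK interval_Delta_mono
  interval_impK interval_impCA.

End Interval.

(* Main.v *)
(* In any cubic algebra the intervals [[a, \top]] are Boolean, and [csim] is an
   equivalence compatible with the order: if [x ~ y <= z], then [x <= w] for
   some [w ~ z].  It follows that a g-cover is the same as an upward closed set
   [J] which meets each class exactly once.  For such a [J], write [j] for the
   representative of [x] in [J]; then [j `|` x] is the least element of [J]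
   above [x], so that [x |-> (j `|` x, j `|` Delta \top x)] preserves joins and
   [Delta \top].  This suffices, because [Delta y x] is the meet of [y] and
   [Delta \top (cimp y x)], where [cimp y x] is a complement determined by the
   order.  Conversely the elements [(a, \top)] form a g-cover of
   [interval_alg I]. *)
Require Import Defs.
From HB Require Import structures.
From mathcomp Require Import all_boot all_order.
From mathcomp Require Import boolp classical_sets functions.

Set Implicit Arguments.
Unset Strict Implicit.
Unset Printing Implicit Defensive.

Import Order.Theory.
Local Open Scope order_scope.

Arguments Delta_join {d s} [x y].
Arguments DeltaK {d s} [x y].
Arguments Delta_mono {d s} [x y z].

(** * Reflections, implication and local meets in a cubic algebra *)

Section Delta.
Context d (L : cubicType d).
Implicit Types a b t x y z p q : L.

Lemma Delta_le x y : x <= y -> Delta y x <= y.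
Proof. by move=> xy; rewrite -{2}(Delta_join xy) leUl. Qed.

Lemma Deltaxx x : Delta x x = x.
Proof.
apply: le_anti; rewrite Delta_le //=.
by rewrite -{1}(DeltaK (lexx x)) Delta_mono ?Delta_le.
Qed.

Lemma ler_Delta x y z : x <= z -> y <= z -> (Delta z x <= Delta z y) = (x <= y).
Proof.
move=> xz yz; apply/idP/idP => [h|xy]; last exact: Delta_mono.
by rewrite -(DeltaK xz) -(DeltaK yz) Delta_mono ?Delta_le.
Qed.

(** [Delta z] is an involutive order automorphism of the elements below [z], hence respects
    joins. *)
Lemma DeltaU x y z : x <= z -> y <= z ->
  Delta z (x `|` y) = Delta z x `|` Delta z y.
Proof.
move=> xz yz; have xyz : x `|` y <= z by rewrite leUx xz.
apply: le_anti; rewrite leUx !Delta_mono ?leUl ?leUr // !andbT.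
have uz : Delta z x `|` Delta z y <= z by rewrite leUx !Delta_le.
rewrite -[leRHS](DeltaK uz) ler_Delta // ?Delta_le // leUx.
by rewrite -{1}(DeltaK xz) -{2}(DeltaK yz) !ler_Delta // ?Delta_le // leUl leUr.
Qed.

Lemma cimpE x y : y <= x -> cimp x y = Delta \top (Delta x y) `|` y.
Proof. by move=> yx; rewrite /cimp /cubic_imp_of (join_l yx). Qed.

Lemma cimp_joinl x y : cimp (x `|` y) y = cimp x y.
Proof. by rewrite /cimp /cubic_imp_of joinUK. Qed.

Lemma cimp_ge x y : y <= cimp x y.
Proof. exact: leUr. Qed.

Lemma cimpK x y : cimp (cimp x y) y = x `|` y.
Proof. exact: cubic_impK. Qed.

Lemma cimpCA x y z : cimp x (cimp y z) = cimp y (cimp x z).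
Proof. exact: cubic_impCA. Qed.

Lemma cimp_eq1 x y : (cimp x y == \top) = (x <= y).
Proof.
apply/eqP/idP => [h|xy].
  have := cimpK x y; rewrite h (cimpE (lex1 y)) (DeltaK (lex1 y)) joinxx => ->.
  exact: leUl.
by rewrite -cimp_joinl (join_r xy) (cimpE (lexx y)) Deltaxx Delta_join ?lex1.
Qed.

(** By exchange, both sides say that [cimp x (cimp y z)] is [\top]. So [cimp _ z] is in antitone
    Galois connection with itself, whence the monotonicity laws. *)
Lemma le_cimp x y z : (x <= cimp y z) = (y <= cimp x z).
Proof. by rewrite -!cimp_eq1 cimpCA. Qed.

Lemma cimp_anti x y z : x <= y -> cimp y z <= cimp x z.
Proof. by move=> xy; rewrite le_cimp cimpK lexU2 ?xy. Qed.

Lemma cimp_mono x y z : y <= z -> cimp x y <= cimp x z.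
Proof. by move=> yz; rewrite -(join_l yz) -cimpK cimpCA cimp_ge. Qed.

(** With [u = Delta (x]|[y) y], [\top] is the join of [Delta \top u], which is below the
    implication, and [u], which is below [x]|[y]. *)
Lemma cimp_join x y : x `|` cimp x y = \top.
Proof.
apply: le_anti; rewrite lex1 /= -cimp_joinl.
have h : y <= x `|` y by exact: leUr.
rewrite -(@Delta_join _ L _ _ (lex1 (Delta (x `|` y) y))) (cimpE h) leUx.
rewrite lexU2 ?leUl ?orbT //=; apply: le_trans (Delta_le h) _.
by rewrite leUx leUl lexU2 // leUr orbT.
Qed.

(** Since [t <= cimp x y <= cimp t y], the join [t]|[cimp t y = \top] is [cimp t y] itself. This
    replaces reasoning with meets, which need not exist. *)
Lemma cimp_mp t x y : t <= x -> t <= cimp x y -> t <= y.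
Proof.
move=> tx txy; have tty : t <= cimp t y by apply: le_trans txy (cimp_anti _ tx).
by rewrite -cimp_eq1 -(cimp_join t y) (join_r tty).
Qed.

Lemma le_joinP t x y : t <= x `|` y -> t <= cimp x y -> t <= y.
Proof. by rewrite -cimpK => h1 h2; exact: cimp_mp h2 h1. Qed.

(** De Morgan form of the meet in [[a, \top]], where [cimp _ a] is complementation. *)
Definition cmeet a x y : L := cimp (cimp x (cimp y a)) a.

Lemma cmeet_ge a x y : a <= cmeet a x y.
Proof. exact: cimp_ge. Qed.

Lemma cmeet_lel a x y : a <= x -> cmeet a x y <= x.
Proof.
move=> ax; rewrite -[leRHS](join_l ax) -cimpK.
exact/cimp_anti/cimp_mono/cimp_ge.
Qed.

Lemma cmeetC a x y : cmeet a x y = cmeet a y x.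
Proof. by rewrite /cmeet cimpCA. Qed.

Lemma cmeet_ler a x y : a <= y -> cmeet a x y <= y.
Proof. by rewrite cmeetC; exact: cmeet_lel. Qed.

Lemma le_cimp_cmeet a x y : y <= cimp x (cmeet a x y).
Proof. by rewrite -cimp_eq1 /cmeet cimpCA (cimpCA y) cimpK cimp_eq1 leUl. Qed.

Lemma le_cmeet a t x y : t <= x -> t <= y -> t <= cmeet a x y.
Proof.
by move=> tx ty; apply: cimp_mp tx (le_trans ty _); exact: le_cimp_cmeet.
Qed.

Lemma cmeet_leP a x y z : a <= x -> a <= y ->
  (forall t, a <= t -> t <= x -> t <= y -> t <= z) -> y <= cimp x z.
Proof.
move=> ax ay h; apply: le_trans (le_cimp_cmeet a x y) (cimp_mono _ _).
by apply: h; [exact: cmeet_ge|exact: cmeet_lel|exact: cmeet_ler].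
Qed.

Lemma cmeetUr a x y z : a <= x -> a <= y -> a <= z ->
  cmeet a x (y `|` z) = cmeet a x y `|` cmeet a x z.
Proof.
move=> ax ay az; have ayz : a <= y `|` z by rewrite lexU2 ?ay.
apply: le_anti; apply/andP; split; last first.
  by rewrite leUx !le_cmeet ?cmeet_lel // lexU2 // cmeet_ler ?orbT.
apply: (@cimp_mp _ x); first exact: cmeet_lel.
apply: le_trans (cmeet_ler _ ayz) _; rewrite leUx; apply/andP.
by split; apply: le_trans (le_cimp_cmeet a x _) (cimp_mono _ _);
  [exact: leUl|exact: leUr].
Qed.

(** The hypotheses involve only order and joins, so every join isomorphism will preserve [cimp]. *)
Lemma cimp_unique x y w : y <= w -> x `|` w = \top ->
  (forall t, y <= t -> t <= x `|` y -> t <= w -> t <= y) -> w = cimp x y.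
Proof.
move=> yw xw h; apply: le_anti; apply/andP; split.
  by rewrite -cimp_joinl; apply: (cmeet_leP (leUr _ _) yw); exact: h.
apply: (@le_joinP _ x); first by rewrite xw lex1.
exact: cimp_mono.
Qed.

(* The left-hand side is the complement of [y] in the interval [[x, z]]. *)
Lemma le_relcompl x y z t : x <= y -> y <= z ->
  (t <= Delta z (Delta y x) `|` x) = (t <= z) && (t <= cimp y x).
Proof.
move=> xy yz; have xz := le_trans xy yz; set u := Delta y x.
have uz : u <= z by apply: le_trans (Delta_le xy) yz.
have wc : Delta z u `|` x <= cimp y x.
  rewrite leUx cimp_ge andbT (cimpE xy) -/u.
  have xE : x = Delta y u by rewrite DeltaK.
  have uy : u <= y by exact: Delta_le.
  (* Applying [Delta \top] to both sides leaves [Delta \top (Delta z u) <= cimp y u], and the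
     left-hand side is below [cimp z u]. *)
  rewrite -(DeltaK (lex1 (Delta z u))) xE.
  rewrite -(DeltaK (lex1 (Delta y u))) -DeltaU ?lex1 //.
  rewrite ler_Delta ?lex1 //.
  apply: (@le_trans _ _ (cimp z u)); first by rewrite cimpE // leUl.
  by apply: le_trans (cimp_anti _ yz) _; rewrite cimpE // joinC.
apply/idP/andP => [h|[tz tc]].
  split; last exact: le_trans h wc.
  by apply: le_trans h _; rewrite leUx Delta_le.
apply: (@le_joinP _ y); last by apply: le_trans tc (cimp_mono _ _); exact: leUr.
apply: le_trans tz _; rewrite -{1}(Delta_join uz) leUx lexU2 ?leUl ?orbT //=.
by rewrite lexU2 // Delta_le.
Qed.

Lemma relcompl_le_cimp x y z : x <= y -> y <= z ->
  Delta z (Delta y x) `|` x <= cimp y x.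
Proof.
move=> xy yz; have := le_relcompl (Delta z (Delta y x) `|` x) xy yz.
by rewrite lexx => /esym/andP[].
Qed.

Lemma Delta_join_le_cimp x y z : x <= y -> y <= z ->
  Delta z x `|` Delta y x <= cimp y (Delta y x).
Proof.
by move=> xy yz; rewrite -{1}(DeltaK xy) relcompl_le_cimp ?Delta_le.
Qed.

(** * The equivalence [csim] and its compatibility with the order *)

Lemma csimxx x : csim x x.
Proof. by rewrite /csim joinxx Deltaxx. Qed.

Lemma csim_sym x y : csim x y -> csim y x.
Proof. by move=> h; rewrite /csim joinC -{2}h DeltaK ?leUl. Qed.

Lemma csim_Delta x z : x <= z -> csim x (Delta z x).
Proof. by move=> xz; rewrite /csim joinC Delta_join. Qed.

Lemma csim_DeltaE z x y : x <= z -> y <= z ->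
  csim x y -> csim (Delta z x) (Delta z y).
Proof.
move=> xz yz h; rewrite /csim -DeltaU // -Delta_distr ?leUl ?leUx ?xz //.
by rewrite h.
Qed.

(* The claim is that [Delta z (Delta y x) = Delta y' x] for the complement [y']
   of [y] in [[x, z]]; one inequality for both [y] and [y'] gives equality. *)
Lemma csim_Delta2 x y z : x <= y -> y <= z -> csim x (Delta z (Delta y x)).
Proof.
move=> xy yz; suff h p : x <= p -> p <= z ->
    Delta z (Delta (Delta z (Delta p x) `|` x) x) <= Delta p x.
  set w := Delta z (Delta y x) `|` x.
  have xw : x <= w by exact: leUr.
  have xz := le_trans xy yz; have yxz := le_trans (Delta_le xy) yz.
  have wz : w <= z by rewrite /w leUx xz Delta_le.
  rewrite /csim joinC -/w; apply: le_anti; apply/andP; split.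
    rewrite -(@ler_Delta _ _ z) ?Delta_le // ?DeltaK //; first exact: h.
    exact: le_trans (Delta_le xw) wz.
  have := h w xw wz; suff -> : Delta z (Delta w x) `|` x = y.
    rewrite -[leRHS](@DeltaK _ _ _ z) ?ler_Delta //.
    + exact: Delta_le (le_trans (Delta_le xw) wz).
    + exact: le_trans (Delta_le xw) wz.
  apply: le_anti; apply/andP; split.
    apply: (@le_joinP _ w).
      apply: (@le_trans _ _ z).
        by rewrite leUx xz Delta_le // (le_trans (Delta_le xw)).
      rewrite -{1}(Delta_join yxz) leUx /w lexU2 ?leUl //=.
      by rewrite lexU2 // Delta_le ?orbT.
    apply: (@le_trans _ _ (cimp w x)); last exact: cimp_mono.
    exact: relcompl_le_cimp.
  rewrite le_relcompl // yz le_cimp.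
  exact: relcompl_le_cimp.
move=> xp pz; have xz := le_trans xp pz; have pxz := le_trans (Delta_le xp) pz.
set w := Delta z (Delta p x) `|` x.
have xw : x <= w by exact: leUr.
have wz : w <= z by rewrite /w leUx xz Delta_le.
have wxz : Delta w x <= z by exact: le_trans (Delta_le xw) wz.
apply: (@cimp_mp _ p).
  apply: (@le_joinP _ w); last first.
    apply: le_trans (cimp_mono w xp).
    exact: le_trans (leUl _ _) (relcompl_le_cimp xw wz).
  apply: le_trans (Delta_le wxz) _; rewrite -{1}(Delta_join pxz) leUx.
  by rewrite lexU2 ?leUl //= lexU2 // Delta_le ?orbT.
(* Reflecting [w] in [z] gives [Delta p x]|[Delta z x], which is below [cimp p (Delta p x)]. *)
have : Delta z (Delta w x) <= Delta z w.
  by apply: Delta_mono => //; exact: Delta_le.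
move=> /le_trans; apply; rewrite /w DeltaU // ?Delta_le // DeltaK // joinC.
exact: Delta_join_le_cimp.
Qed.

(** Disjointness over [x] makes [q] the complement of [p] in [[x, p]|[q]], so [csim_Delta2] turns
    [Delta q x] into a reflection of [Delta p x]. *)
Lemma csim_disjoint x p q : x <= p -> x <= q ->
  (forall t, x <= t -> t <= p -> t <= q -> t <= x) ->
  csim (Delta p x) (Delta q x).
Proof.
move=> xp xq h; set z := p `|` q.
have pz : p <= z by exact: leUl. have qz : q <= z by exact: leUr.
have pxz := le_trans (Delta_le xp) pz.
have -> : Delta q x = Delta z (Delta p x); last exact: csim_Delta.
rewrite -(csim_Delta2 xp pz); congr (Delta _ x); apply: le_anti.
apply/andP; split.
  by rewrite joinC le_relcompl // qz; apply: (cmeet_leP xp xq).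
apply: (@le_joinP _ p); first by rewrite leUx Delta_le // (le_trans xp).
apply: (@le_trans _ _ (cimp p x)); last exact: cimp_mono.
by rewrite joinC; exact: relcompl_le_cimp.
Qed.

(* With [x = Delta p y] and [z = Delta q y], flipping both elements inside
   [w = p `|` q] replaces [p] and [q] by their complements in [[y, w]], which
   are disjoint over [y]. *)
Lemma csim_trans y x z : csim x y -> csim y z -> csim x z.
Proof.
move=> /csim_sym; rewrite /csim => xE zE; rewrite -/(csim x z).
set p := y `|` x in xE; set q := y `|` z in zE; set w := p `|` q.
have yp : y <= p by exact: leUl. have yq : y <= q by exact: leUl.
have pw : p <= w by exact: leUl. have qw : q <= w by exact: leUr.
have xp := Delta_le yp; have zq := Delta_le yq.
rewrite xE in xp; rewrite zE in zq.
have xw := le_trans xp pw; have zw := le_trans zq qw.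
rewrite -(DeltaK xw) -(DeltaK zw); apply: csim_DeltaE; rewrite ?Delta_le //.
have := csim_Delta2 yp pw; have := csim_Delta2 yq qw; rewrite xE zE => <- <-.
apply: csim_disjoint; rewrite ?leUl // => t yt.
have := le_relcompl t yp pw; rewrite xE joinC => -> /andP[tw tp].
have := le_relcompl t yq qw; rewrite zE joinC => -> /andP[_ tq].
apply: (cimp_mp tw).
by rewrite le_cimp leUx (le_cimp p) tp (le_cimp q).
Qed.

Lemma eq_cclass x y : (cclass x = cclass y) <-> csim x y.
Proof.
split=> [e|xy]; first by rewrite -[csim x y]/(cclass x y) e; exact: csimxx.
apply/seteqP; split => t /= h; first exact: csim_trans (csim_sym xy) h.
exact: csim_trans xy h.
Qed.

(** As [x = Delta v y], its reflection in [w] lies below the complement of [v] in [[y, w]], and also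
    below [v]|[z]; removing [v] leaves [z]. *)
Lemma csim_le_Delta x y z : csim x y -> y <= z -> Delta (x `|` z) x <= z.
Proof.
move=> xy yz; set v := y `|` x; set w := x `|` z.
have yv : y <= v by exact: leUl.
have vw : v <= w by rewrite leUx lexU2 ?yz ?orbT //= leUl.
have -> : x = Delta v y by rewrite (csim_sym xy).
apply: (@le_joinP _ v).
  apply: le_trans (Delta_le (le_trans (Delta_le yv) vw)) _.
  by rewrite /w leUx leUr andbT lexU2 // leUr.
apply: (@le_trans _ _ (cimp v y)); last exact: cimp_mono.
exact: le_trans (leUl _ _) (relcompl_le_cimp yv vw).
Qed.

Lemma csim_lift x y z : csim x y -> y <= z -> exists2 w, csim z w & x <= w.
Proof.
move=> xy yz; have xw : x <= x `|` z by exact: leUl.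
exists (Delta (x `|` z) z); first exact/csim_Delta/leUr.
by rewrite -{1}(DeltaK xw) Delta_mono ?leUr // (csim_le_Delta xy).
Qed.

(** Needed to see that [Delta (x]|[y) x]|[y] represents the least upper bound of the two classes.
    Any bound [z] may be cut down to its meet [m] with [v], because [z] lies below the complement of
    [v] in [[m, w]]. *)
Lemma Delta_le_bound x y z : Delta (x `|` z) x <= z -> y <= z ->
  Delta (x `|` y) x <= z.
Proof.
set w := x `|` z; set v := x `|` y => xz yz.
have xw : x <= w by exact: leUl. have xv : x <= v by exact: leUl.
have vw : v <= w by rewrite leUx xw lexU2 // yz orbT.
have yv : y <= v by exact: leUr. have zw : z <= w by exact: leUr.
set m := cmeet y z v.
have mz : m <= z by exact: cmeet_lel. have mv : m <= v by exact: cmeet_ler.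
have mw := le_trans mv vw; have mvw := le_trans (Delta_le mv) vw.
apply: le_trans mz; rewrite -(DeltaK mv) Delta_mono ?Delta_le //.
have zE : z <= Delta w (Delta v m) `|` m.
  by rewrite le_relcompl // zw -le_cimp le_cimp_cmeet.
apply: (@cimp_mp _ v) => //.
have : x <= Delta w z by rewrite -(DeltaK xw) Delta_mono.
move=> /le_trans; apply.
apply: (@le_trans _ _ (Delta w (Delta w (Delta v m) `|` m))).
  by apply: Delta_mono; rewrite // leUx mw Delta_le.
rewrite DeltaU // ?Delta_le // DeltaK // joinC.
exact: Delta_join_le_cimp.
Qed.

(** [Delta \top (cimp y x)] equals [cimp y (Delta y x)], whose meet with [y] is [Delta y x]. *)
Lemma Delta_meet x y t : x <= y ->
  (t <= Delta y x) = (t <= y) && (t <= Delta \top (cimp y x)).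
Proof.
move=> xy; have yx := Delta_le xy.
rewrite cimpE // DeltaU ?lex1 // DeltaK ?lex1 // joinC.
rewrite -{2}(DeltaK xy) -cimpE //.
apply/idP/andP => [h|[]]; last exact: cimp_mp.
by split; [exact: le_trans h yx|exact: le_trans h (cimp_ge _ _)].
Qed.

End Delta.

(** * g-covers as upward closed transversals of [csim] *)

Section GCover.
Context d (L : cubicType d).
Implicit Types (a b t x y z : L) (J : set L).

Definition flat J := forall x y, J x -> J y -> csim x y -> x = y.

Lemma csim_le_trans x y z' z : csim x y -> y <= z' -> csim z' z ->
  exists2 y', csim x y' & y' <= z.
Proof.
move=> xy yz' z'z; have [w z'w xw] := csim_lift xy yz'.
have wz : csim w z by apply: csim_trans (csim_sym z'w) z'z.
have wU : w <= w `|` z by exact: leUl.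
exists (Delta (w `|` z) x); first exact/csim_Delta/(le_trans xw wU).
by rewrite -[leRHS]wz Delta_mono.
Qed.

(** On a flat upset the order of the quotient is that of the algebra: lifting [x] gives an element
    of [J] equivalent to [z], hence [z]. *)
Lemma flat_le J x y z' z : upward_closed J -> flat J -> J x -> J z ->
  csim x y -> y <= z' -> csim z' z -> x <= z.
Proof.
move=> Jup Jflat Jx Jz xy yz' z'z; have [w z'w xw] := csim_lift xy yz'.
rewrite -(Jflat w z) //; first exact: Jup xw.
exact: csim_trans (csim_sym z'w) z'z.
Qed.

Lemma upset_upward_closed b : upward_closed [set t | b <= t]%classic.
Proof. by move=> x y /= bx; exact: le_trans. Qed.

(** Reflection in [x]|[y] sends [x] to [y], so [y] is above both [b] and its reflection, whose join
    is [x]|[y]. *)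
Lemma upset_flat b : flat [set t | b <= t]%classic.
Proof.
suff h x y : b <= x -> b <= y -> csim x y -> x <= y.
  move=> x y /= bx bY xy; apply: le_anti.
  by rewrite (h x y) // (h y x) //; exact: csim_sym.
move=> bx bY xy; have bU : b <= x `|` y by rewrite lexU2 ?bx.
apply: (@le_trans _ _ (x `|` y)); first exact: leUl.
by rewrite -(Delta_join bU) leUx bY andbT -[leRHS]xy Delta_mono ?leUl.
Qed.

(** The class of the implication is found by moving order relations between two flat upsets: [J],
    and the elements above [b], which contain [w] and [c]. The representative of [c] in [J] is then
    a complement as in [cimp_unique]. *)
Lemma csim_cimp J a b x y : upward_closed J -> flat J ->
  (forall x, exists2 j, J j & csim j x) -> J x -> J y ->
  csim a x -> csim b y -> csim (cimp (Delta (a `|` b) a) b) (cimp x y).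
Proof.
move=> Jup Jflat Jcov Jx Jy ax bY; set u := Delta (a `|` b) a.
have au : csim a u by apply/csim_Delta/leUl.
rewrite -(cimp_joinl u) -(cimp_joinl x); set w := u `|` b; set c := cimp w b.
have bw : b <= w by exact: leUr.
have bc : b <= c by exact: cimp_ge.
have Bup := @upset_upward_closed b; have Bflat := @upset_flat b.
have Jxy : J (x `|` y) by apply: Jup Jx (leUl _ _).
have [k Jk kw] := Jcov w; have [e Je ec] := Jcov c.
have kE : k = x `|` y.
  apply: le_anti; apply/andP; split; last first.
    rewrite leUx (flat_le Jup Jflat Jx Jk _ (leUl u b) (csim_sym kw)) /=.
      exact: flat_le Jup Jflat Jy Jk (csim_sym bY) bw (csim_sym kw).
    exact: csim_trans (csim_sym ax) au.
  (* Both [u] and [b] lie below a single [k1] equivalent to [x]|[y]. *)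
  have [k1 k1E bk1] := csim_lift bY (leUr y x).
  have [a' aa' a'k1] := csim_le_trans ax (leUl x y) k1E.
  apply: flat_le Jup Jflat Jk Jxy kw _ (csim_sym k1E).
  by rewrite leUx bk1 andbT Delta_le_bound // (csim_le_Delta aa').
suff -> : cimp (x `|` y) y = e by exact: csim_sym.
rewrite -kE; apply/esym/cimp_unique.
- exact: flat_le Jup Jflat Jy Je (csim_sym bY) bc (csim_sym ec).
(* Lifts of [k]|[e] above [c] and above [w] coincide by flatness over [b], so they are above
   [w]|[c = \top]. *)
- have [c1 hc1 cc1] := csim_lift (csim_sym ec) (leUr e k).
  have [w1 hw1 ww1] := csim_lift (csim_sym kw) (leUl k e).
  have c1E : c1 = w1.
    apply: Bflat; [exact: le_trans bc cc1|exact: le_trans bw ww1|].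
    exact: csim_trans (csim_sym hc1) hw1.
  have w11 : w1 = \top.
    by apply: le_anti; rewrite lex1 -(cimp_join w b) leUx ww1 -c1E.
  have Jh : J (k `|` e) by apply: Jup Jk (leUl _ _).
  by apply: Jflat => //; [exact: Jup Jh (lex1 _)|rewrite -w11].
(* A common lower bound [t] is transported to [t'] above [b], where [w] and [c] meet in [b]. *)
- move=> t yt; rewrite kE -joinA joinxx -kE => tk te.
  have [t' tt' bt'] := csim_lift bY yt; have t't := csim_sym tt'.
  have t'c : t' <= c by apply: flat_le Bup Bflat bt' bc t't te ec.
  have t'w : t' <= w by apply: flat_le Bup Bflat bt' bw t't tk kw.
  exact: flat_le Jup Jflat (Jup _ _ Jy yt) Jy tt' (cimp_mp t'w t'c) bY.
Qed.

Lemma g_coverP J : g_cover J <->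
  [/\ upward_closed J, flat J & forall x, exists2 j, J j & csim j x].
Proof.
split=> [[Jup _ [_ Jinj Jsurj] _]|[Jup Jflat Jcov]].
  split=> // [x y Jx Jy xy|x].
    by apply: Jinj; rewrite ?inE //; exact/eq_cclass.
  have [|j Jj jx] := Jsurj (cclass x); first by exists x.
  by exists j => //; exact/eq_cclass.
split=> //.
- by move=> x y _ Jy; apply: Jup Jy (cimp_ge _ _).
- split=> [x _|x y|_ [x _ <-]]; first by exists x.
    by rewrite !inE => Jx Jy /eq_cclass; exact: Jflat.
  by have [j Jj jx] := Jcov x; exists j => //; exact/eq_cclass.
- move=> x y Jx Jy; apply/seteqP; split => [t xyt|t [a xa [b yb abt]]].
    exists x; first exact: csimxx; exists y; first exact: csimxx.
    apply: csim_trans xyt; apply: (csim_cimp Jup Jflat Jcov) => //;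
      exact: csimxx.
  apply: csim_trans abt; apply/csim_sym.
  by apply: (csim_cimp Jup Jflat Jcov) => //; exact: csim_sym.
Qed.

End GCover.

(** * Upsets as implication algebras *)

Section UpsetImplication.
Context d (L : cubicType d) (J : set L).

(** The closure proofs are parameters of the type, so that structure instances on it can recover
    them. *)
Definition upset_type of upward_closed J & J \top := {x : L | `[< J x >]}.

Context (Jup : upward_closed J) (J1 : J \top).

Local Notation T := (upset_type Jup J1).

HB.instance Definition _ := SubChoice.on T.
HB.instance Definition _ := [SubChoice_isSubPOrder of T by <: with d].

Implicit Types (a x y : T).

Lemma upset_valP x : J (val x).
Proof. exact/asboolP/(valP x). Qed.

Definition upset_Sub (x : L) (Jx : J x) : T := Sub x (asboolT Jx).

Definition upset_join x y : T :=
  upset_Sub (Jup (upset_valP x) (leUl (val x) (val y))).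

Fact upset_leUx x y z : (upset_join x y <= z) = (x <= z) && (y <= z).
Proof. exact: leUx. Qed.

HB.instance Definition _ := Order.POrder_isJoinSemilattice.Build d T upset_leUx.

Fact upset_lex1 x : x <= upset_Sub J1.
Proof. exact: lex1. Qed.

HB.instance Definition _ := Order.hasTop.Build d T upset_lex1.

Definition upset_meet a x y : T :=
  upset_Sub (Jup (upset_valP a) (cmeet_ge (val a) (val x) (val y))).

Lemma upset_infimum a x y : a <= x -> a <= y ->
  infimums [set x; y]%classic (upset_meet a x y).
Proof.
move=> ax ay; apply/infimums2P; split=> [||z].
- exact: cmeet_lel.
- exact: cmeet_ler.
- exact: le_cmeet.
Qed.

Lemma pmeet_upset a x y : a <= x -> a <= y -> pmeet x y = upset_meet a x y.
Proof.
by move=> ax ay; have /infimums2P[] := upset_infimum ax ay; exact: pmeet_unique.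
Qed.

Definition upset_imp x y : T :=
  upset_Sub (Jup (upset_valP y) (cimp_ge (val x) (val y))).

Fact upset_imp_join x y : (x `|` y) `|` upset_imp x y = \top.
Proof.
by apply: val_inj; rewrite /= -joinA (join_r (cimp_ge _ _)) cimp_join.
Qed.

Fact upset_imp_meet x y : pmeet (x `|` y) (upset_imp x y) = y.
Proof.
apply: pmeet_unique; [exact: leUr|exact: cimp_ge|move=> z zx zi].
exact: le_joinP zx zi.
Qed.

Fact upset_boolean_above a : boolean_above a.
Proof.
split=> [x y ax ay|x y z ax ay az|x ax].
- by exists (upset_meet a x y); exact: upset_infimum.
- have ayz : a <= y `|` z by rewrite lexU2 ?ay.
  rewrite (pmeet_upset ax ayz) (pmeet_upset ax ay) (pmeet_upset ax az).
  by apply: val_inj; exact: cmeetUr.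
- exists (upset_imp x a); split; first exact: cimp_ge.
    by have := upset_imp_join x a; rewrite (join_l ax).
  by have := upset_imp_meet x a; rewrite (join_l ax).
Qed.

HB.instance Definition _ := @isImplication.Build d T
  upset_boolean_above upset_imp (fun x y => cimp_ge (val x) (val y))
  upset_imp_join upset_imp_meet.

End UpsetImplication.

(** * Join isomorphisms that commute with [Delta \top] *)

Section Isomorphism.
Context d d' (L : cubicType d) (M : cubicType d') (f : L -> M).
Hypotheses (fbij : bijective f) (fU : {morph f : x y / x `|` y}).

Lemma join_iso_le x y : (f x <= f y) = (x <= y).
Proof. by rewrite !leEjoin -fU (bij_eq fbij). Qed.

Lemma join_iso_top : f \top = \top.
Proof.
have [g _ gK] := fbij.
by apply: le_anti; rewrite lex1 -{1}(gK \top) join_iso_le lex1.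
Qed.

Lemma join_iso_cimp x y : f (cimp x y) = cimp (f x) (f y).
Proof.
have [g _ gK] := fbij; apply: cimp_unique.
- by rewrite join_iso_le cimp_ge.
- by rewrite -fU cimp_join join_iso_top.
- move=> t _; rewrite -(gK t) -fU !join_iso_le; exact: le_joinP.
Qed.

Lemma cubic_iso_of_join_iso :
  (forall x, f (Delta \top x) = Delta \top (f x)) -> cubic_iso f.
Proof.
move=> fD; split=> //; first exact: join_iso_top.
move=> x y xy; have fxy : f x <= f y by rewrite join_iso_le.
have [g _ gK] := fbij; apply: le_anti; apply/andP; split.
  rewrite (Delta_meet _ fxy) -join_iso_cimp -fD !join_iso_le.
  by rewrite -(Delta_meet _ xy).
rewrite -(gK (Delta (f y) (f x))) join_iso_le (Delta_meet _ xy).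
rewrite -join_iso_le -[_ <= Delta _ _]join_iso_le fD join_iso_cimp gK.
by rewrite -(Delta_meet _ fxy).
Qed.

Lemma cubic_iso_csim x y : cubic_iso f -> csim (f x) (f y) <-> csim x y.
Proof.
case=> _ _ _ fD; rewrite /csim -fU -fD ?leUl //.
by split=> [|->//]; exact: bij_inj.
Qed.

End Isomorphism.

Section ImplicationTop.
Context d (I : implType d).
Implicit Types p : I.

Lemma pmeet1x p : pmeet \top p = p.
Proof. by apply: pmeet_unique; rewrite ?lex1. Qed.

Lemma imp1x p : imp \top p = p.
Proof. by apply: imp_unique; rewrite ?join1x // pmeet1x. Qed.

Lemma impxx p : imp p p = \top.
Proof.
by apply: imp_unique; rewrite ?lex1 // ?joinx1 // joinxx pmeetC pmeet1x.
Qed.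

End ImplicationTop.

(** * From a g-cover to an interval algebra *)

Section CoverIsomorphism.
Context d (L : cubicType d) (J : set L).
Context (Jup : upward_closed J) (J1 : J \top).
Context (Jflat : flat J) (Jcov : forall x, exists2 j, J j & csim j x).

Local Notation T := (upset_type Jup J1).
Implicit Types (x y : L) (k m : T).

Definition cover_rep x : L := s2val (cid2 (Jcov x)).

Lemma cover_repJ x : J (cover_rep x).
Proof. exact: (s2valP (cid2 (Jcov x))). Qed.

Lemma cover_rep_csim x : csim (cover_rep x) x.
Proof. exact: (s2valP' (cid2 (Jcov x))). Qed.

Lemma cover_repE j x : J j -> csim j x -> cover_rep x = j.
Proof.
move=> Jj jx; apply: Jflat (cover_repJ x) Jj _.
exact: csim_trans (cover_rep_csim x) (csim_sym jx).
Qed.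

Definition cover_hull x : T :=
  upset_Sub Jup J1 (Jup (cover_repJ x) (leUl (cover_rep x) x)).

(** The hull is left adjoint to the inclusion of [J], hence preserves joins; [flat_le] bounds the
    representative. *)
Lemma cover_hull_le x k : (cover_hull x <= k) = (x <= val k).
Proof.
apply/idP/idP => [|xk]; first exact: le_trans (leUr _ _).
rewrite -Order.le_val leUx xk andbT.
exact: flat_le Jup Jflat (cover_repJ x) (upset_valP k) (cover_rep_csim x) xk
  (csimxx _).
Qed.

Lemma cover_hullU x y : cover_hull (x `|` y) = cover_hull x `|` cover_hull y.
Proof.
apply: le_anti; rewrite leUx !cover_hull_le; apply/andP; split.
  by rewrite leU2 //; exact: leUr.
apply/andP; split; apply: le_trans (leUr _ _); [exact: leUl|exact: leUr].
Qed.

Lemma cover_rep_Delta1 x : cover_rep (Delta \top x) = cover_rep x.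
Proof.
apply: cover_repE (cover_repJ x) _.
exact: csim_trans (cover_rep_csim x) (csim_Delta (lex1 x)).
Qed.

Fact cover_map_subproof x :
  `[< is_interval (cover_hull x, cover_hull (Delta \top x)) >].
Proof.
apply/asboolP; split => /=.
  rewrite -cover_hullU joinC Delta_join ?lex1 //.
  by apply: le_anti; rewrite lex1; exact: leUr.
apply: (@has_meet_bounded _ _ (upset_Sub Jup J1 (cover_repJ x))).
  exact: leUl.
by rewrite -Order.le_val /= cover_rep_Delta1 leUl.
Qed.

Definition cover_map x : interval_alg T :=
  exist _ (_, _) (cover_map_subproof x).

(** The two coordinates of [cover_map x] are complements over the representative [j], because
    [Delta (j]|[x) j = x]. *)
Lemma hull_Delta1_rep x :
  val (cover_hull (Delta \top x)) = cimp (val (cover_hull x)) (cover_rep x).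
Proof.
rewrite /= cover_rep_Delta1 cimpE ?leUl // joinC.
by rewrite (cover_rep_csim x).
Qed.

Lemma cover_map_bij : bijective cover_map.
Proof.
(* The representative of [x] is the meet of the two coordinates, and reflecting it in the first one,
   [j]|[x], returns [x]. *)
pose g (u : interval_alg T) : L :=
  Delta (val (val u).1) (val (pmeet (val u).1 (val u).2)).
exists g => [x|u].
  rewrite /g /=; set r := upset_Sub Jup J1 (cover_repJ x).
  have -> : cover_hull (Delta \top x) = imp (cover_hull x) r.
    by apply: val_inj; rewrite hull_Delta1_rep.
  have -> : pmeet (cover_hull x) (imp (cover_hull x) r) = r.
    have := imp_meet (cover_hull x) r; rewrite (join_l _) //; exact: leUl.
  exact: cover_rep_csim.
have [uT uM] := intervalP u; have [mp mq mM] := pmeetP uM.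
rewrite /g; set m := pmeet _ _ in mp mq mM *.
set p := (val u).1 in uT uM mp mq mM *.
(* A pair is determined by its first coordinate and its meet. *)
have qE : imp p m = (val u).2.
  by apply: imp_unique; rewrite ?(join_l mp).
have rE : cover_rep (Delta (val p) (val m)) = val m.
  by apply: cover_repE; [exact: upset_valP|exact: csim_Delta].
have hE : cover_hull (Delta (val p) (val m)) = p.
  by apply: val_inj; rewrite /= rE joinC Delta_join.
apply: val_inj; rewrite [val u]surjective_pairing -qE -/p.
rewrite [LHS]/= hE; congr (_, _).
by apply: val_inj; rewrite hull_Delta1_rep rE hE.
Qed.

Lemma cover_map_iso : cubic_iso cover_map.
Proof.
apply: cubic_iso_of_join_iso; first exact: cover_map_bij.
  move=> x y; apply: val_inj; rewrite /= cover_hullU DeltaU ?lex1 //.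
  by rewrite cover_hullU.
(* In an interval algebra [Delta \top] swaps the coordinates. *)
move=> x; apply: val_inj; rewrite interval_DeltaE ?lex1 //= DeltaK ?lex1 //.
by rewrite !imp1x !pmeet1x.
Qed.

End CoverIsomorphism.

(** * From an interval algebra to a g-cover *)

Section IntervalCover.
Context d (I : implType d).
Implicit Types x y : interval_alg I.

Definition right_edge : set (interval_alg I) :=
  [set x | (val x).2 = \top]%classic.

Lemma right_edge_upward_closed : upward_closed right_edge.
Proof.
move=> x y /= x2; rewrite interval_le x2 => /andP[_ y2].
by apply: le_anti; rewrite lex1.
Qed.

(** For [x ~ y] on the edge, the second coordinate of [Delta (x]|[y) x = y] says that the first
    coordinate of [x]|[y] implies that of [x]. *)
Lemma right_edge_flat : flat right_edge.
Proof.
suff h x y : right_edge x -> right_edge y -> csim x y -> (val y).1 <= (val x).1.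
  move=> x y Jx Jy xy; apply: val_inj.
  rewrite [val x]surjective_pairing [val y]surjective_pairing.
  rewrite (Jx : (val x).2 = _) (Jy : (val y).2 = _); congr (_, _).
  by apply: le_anti; rewrite (h x y) // (h y x) //; exact: csim_sym.
move=> /= x2 y2 xy.
have := interval_DeltaE (leUl x y).
rewrite -[interval_Delta _ _]/(Delta _ _) xy.
move=> /(congr1 snd) /=; rewrite x2 y2 joinxx pmeet1x => e.
have := imp_meet ((val x).1 `|` (val y).1) (val x).1.
rewrite -e (join_l (leUl _ _)) pmeetC pmeet1x => <-; exact: leUr.
Qed.

Lemma right_edge_cover x : exists2 j, right_edge j & csim j x.
Proof.
have [x12 hm] := intervalP x; have [m1 m2 _] := pmeetP hm.
set m := pmeet _ _ in m1 m2.
(* The witness [(m, \top)] is the reflection of [x] in [((val x).1, \top)]. *)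
have mI : `[< is_interval (m, \top) >].
  apply/asboolP; split; first exact: joinx1.
  exact: (has_meet_bounded (lexx m) (lex1 m)).
exists (exist _ (m, \top) mI) => //; apply: csim_sym; rewrite /csim.
apply: val_inj; rewrite interval_DeltaE ?leUl //=.
by rewrite (join_l m1) joinx1 imp1x impxx pmeet1x.
Qed.

End IntervalCover.

Theorem theorem5p6 (d : Order.disp_t) (L : cubicType d) :
  (exists J : set L, g_cover J) <->
  (exists (d' : Order.disp_t) (I : implType d') (f : L -> interval_alg I),
     cubic_iso f).
Proof.
split=> [[J /g_coverP[Jup Jflat Jcov]]|[d' [I [f fiso]]]].
  have J1 : J \top by have [j Jj _] := Jcov \top; exact: Jup Jj (lex1 j).
  exists d, (upset_type Jup J1), (cover_map Jup J1 Jflat Jcov).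
  exact: cover_map_iso.
have [fbij fU _ _] := fiso.
(* By [g_coverP] only order and [csim] matter; [f] preserves and reflects both. *)
exists (f @^-1` @right_edge d' I)%classic; apply/g_coverP; split.
- move=> x y Jx xy; apply: right_edge_upward_closed Jx _.
  by rewrite (join_iso_le fbij fU).
- move=> x y Jx Jy /(cubic_iso_csim fbij fU _ _ fiso) xy.
  exact/(bij_inj fbij)/right_edge_flat.
- move=> x; have [j Jj jx] := right_edge_cover (f x).
  have [g _ gK] := fbij; exists (g j); first by rewrite /preimage /= gK.
  by apply/(cubic_iso_csim fbij fU _ _ fiso); rewrite gK.
Qed.
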